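(* Let $U\subseteq\mathbb{R}^{d_{\mathrm{param}}}$ be an open set and let the loss function $\mathcal{L}:U\to\mathbb{R}$ be of class $C^3$ on $U$. Let $\bm{\theta}_a,\bm{\theta}_b$ be two model parameters and $\pi$ a permutation such that $\bm{\theta}_a,\pi(\bm{\theta}_b)\in U$ and $\lambda\bm{\theta}_a+(1-\lambda)\pi(\bm{\theta}_b)\in U$ for every $\lambda\in(0,1)$. Let $\bm{H}_a$ and $\bm{H}_b$ be the Hessian matrices of $\mathcal{L}$ at $\bm{\theta}_a$ and $\pi(\bm{\theta}_b)$ respectively, let $\beta=\|\bm{\theta}_a-\pi(\bm{\theta}_b)\|>0$ and let $\bm{\mu}=(\pi(\bm{\theta}_b)-\bm{\theta}_a)/\beta$. Then $$B(\bm{\theta}_a,\pi(\bm{\theta}_b))=\max_{\lambda\in[0,1]}\lambda(1-\lambda)\Big[\beta\,\bm{\mu}^\top\big(\nabla\mathcal{L}(\bm{\theta}_a)-\nabla\mathcal{L}(\pi(\bm{\theta}_b))\big)+\tfrac12\beta^2\,\bm{\mu}^\top\big((1-\lambda)\bm{H}_a+\lambda\bm{H}_b\big)\bm{\mu}\Big]+O(\beta^3)$$ as $\beta\to0$. Here the Landau symbol means: for fixed $\mathcal{L}$ and $\bm{\theta}_a$ there exist constants $K,\delta>0$ such that, for all $\bm{\theta}_b$ and $\pi$ with $\pi(\bm{\theta}_b)\in U$, $\lambda\bm{\theta}_a+(1-\lambda)\pi(\bm{\theta}_b)\in U$ for every $\lambda\in(0,1)$, and $0<\beta<\delta$, the absolute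 value of the difference between $B(\bm{\theta}_a,\pi(\bm{\theta}_b))$ and the maximum on the right-hand side is at most $K\beta^3$.
   Context: Model parameters are vectors in $\mathbb{R}^{d_{\mathrm{param}}}$. For an $L$-layer multilayer perceptron, $\bm{\theta}$ is the concatenation of all vectorized weight matrices $\bm{W}_\ell$ and biases $\bm{b}_\ell$, $\ell=1,\dots,L$. A permutation $\pi=(\bm{P}_\ell)_{\ell}$ is a tuple of permutation matrices, with $\bm{P}_0=\bm{I}$ and $\bm{P}_L=\bm{I}$, acting on $\bm{\theta}$ by $\bm{W}_\ell\mapsto\bm{P}_\ell\bm{W}_\ell\bm{P}_{\ell-1}^\top$ and $\bm{b}_\ell\mapsto\bm{P}_\ell\bm{b}_\ell$; the result is denoted $\pi(\bm{\theta})$. The loss barrier between parameters $\bm{\theta}_1$ and $\bm{\theta}_2$ (with the segment joining them in the domain of $\mathcal{L}$) is $$B(\bm{\theta}_1,\bm{\theta}_2)=\max_{\lambda\in[0,1]}\Big(\mathcal{L}(\lambda\bm{\theta}_1+(1-\lambda)\bm{\theta}_2)-\big(\lambda\mathcal{L}(\bm{\theta}_1)+(1-\lambda)\mathcal{L}(\bm{\theta}_2)\big)\Big).$$ $\nabla$ denotes the gradient with respect to the parameters and $\|\cdot\|$ the Euclidean norm. *)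

(* Defs.v *)
From HB Require Import structures.
From mathcomp Require Import all_boot all_order all_algebra.
From mathcomp Require Import all_classical all_reals all_analysis.

Set Implicit Arguments.
Unset Strict Implicit.
Unset Printing Implicit Defensive.

Import Order.TTheory GRing.Theory Num.Theory.
Import numFieldNormedType.Exports.

Local Open Scope classical_set_scope.
Local Open Scope ring_scope.

Section EuclideanCalculus.
Context {R : realType} {n : nat}.
Implicit Types (f : 'cV[R]_n -> R) (U : set 'cV[R]_n) (x : 'cV[R]_n).

(* The norm of the normed module 'cV[R]_n is the sup norm (with the same
   topology), hence a separate Euclidean norm. *)
Definition enorm x : R := Num.sqrt (\sum_i x i 0 ^+ 2).

Definition partial (i : 'I_n) f x : R := 'D_(delta_mx i 0) f x.

Definition gradient f x : 'cV[R]_n := \col_i partial i f x.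

Definition hessian f x : 'M[R]_n := \matrix_(i, j) partial i (partial j f) x.

(* C^k on U: all partial derivatives of order at most k exist and are
   continuous at every point of U.  Used for open U only, where this depends
   only on the values of f on U. *)
Fixpoint class_C (k : nat) U f : Prop :=
  (forall x, U x -> {for x, continuous f}) /\
  match k with
  | 0%N => True
  | k'.+1 => forall i : 'I_n,
      (forall x, U x -> derivable f x (delta_mx i 0)) /\
      class_C k' U (partial i f)
  end.

End EuclideanCalculus.

Section Barrier.
Context {R : realType}.

Definition attains_max01 (f : R -> R) : Prop :=
  exists2 l0, l0 \in `[0, 1] & forall l, l \in `[0, 1] -> f l <= f l0.

(* This is the maximum of f over [0, 1] when attains_max01 f holds. *)
Definition max01 (f : R -> R) : R := sup (f @` `[0, 1]).

Definition barrier_gap n (f : 'cV[R]_n -> R) (t1 t2 : 'cV[R]_n) (l : R) : R :=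
  f (l *: t1 + (1 - l) *: t2) - (l * f t1 + (1 - l) * f t2).

Definition loss_barrier n (f : 'cV[R]_n -> R) (t1 t2 : 'cV[R]_n) : R :=
  max01 (barrier_gap f t1 t2).

End Barrier.

Section MLP.
Context {R : realType} {L : nat}.
(* d i is the width of layer i, for i = 0, ..., L (d 0: input, d L: output). *)
Variable d : 'I_L.+1 -> nat.

(* The weights and biases are indexed by l : 'I_L, which stands for the
   (l+1)-st affine map, from layer l to layer l+1. *)
Definition src (l : 'I_L) : 'I_L.+1 := widen_ord (leqnSn L) l.
Definition tgt (l : 'I_L) : 'I_L.+1 := lift ord0 l.

Definition layer_dim (l : 'I_L) : nat := (d (tgt l) * d (src l) + d (tgt l))%N.

Definition param_dim : nat := (\sum_(l < L) layer_dim l)%N.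

(* Concatenation of vec(W_1), b_1, ..., vec(W_L), b_L; as usual with mxvec,
   matrices are vectorized row by row. *)
Definition mlp_param (W : forall l : 'I_L, 'M[R]_(d (tgt l), d (src l)))
    (b : forall l : 'I_L, 'cV[R]_(d (tgt l))) : 'cV[R]_param_dim :=
  \mxcol_(l < L) (col_mx (mxvec (W l))^T (b l) : 'cV[R]_(layer_dim l)).

Definition mlp_block (t : 'cV[R]_param_dim) (l : 'I_L) :
    'cV[R]_(d (tgt l) * d (src l) + d (tgt l)) :=
  @submxcol R L layer_dim 1 t l.

Definition mlp_weight (t : 'cV[R]_param_dim) (l : 'I_L) :
    'M[R]_(d (tgt l), d (src l)) :=
  vec_mx (usubmx (mlp_block t l))^T.

Definition mlp_bias (t : 'cV[R]_param_dim) (l : 'I_L) : 'cV[R]_(d (tgt l)) :=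
  dsubmx (mlp_block t l).

Definition is_layer_perm (P : forall i : 'I_L.+1, 'M[R]_(d i)) : Prop :=
  [/\ forall i, is_perm_mx (P i), P ord0 = 1%:M & P ord_max = 1%:M].

Definition perm_act (P : forall i : 'I_L.+1, 'M[R]_(d i))
    (t : 'cV[R]_param_dim) : 'cV[R]_param_dim :=
  mlp_param (fun l => P (tgt l) *m mlp_weight t l *m (P (src l))^T)
            (fun l => P (tgt l) *m mlp_bias t l).

Lemma mlp_weightK W b l : mlp_weight (mlp_param W b) l = W l.
Proof.
by rewrite /mlp_weight /mlp_block /mlp_param mxcolK col_mxKu trmxK mxvecK.
Qed.

Lemma mlp_biasK W b l : mlp_bias (mlp_param W b) l = b l.
Proof. by rewrite /mlp_bias /mlp_block /mlp_param mxcolK col_mxKd. Qed.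

Lemma mlp_paramK t : mlp_param (mlp_weight t) (mlp_bias t) = t.
Proof.
rewrite -[RHS](@submxcolK R L layer_dim 1); apply: eq_mxcol => l.
by rewrite /mlp_weight vec_mxK trmxK vsubmxK.
Qed.

End MLP.

(* Main.v *)
Require Import Defs.
From HB Require Import structures.
From mathcomp Require Import all_boot all_order all_algebra.
From mathcomp Require Import all_classical all_reals all_analysis.
From mathcomp Require Import ring lra.

(* Along the segment s |-> ta + s *: (tb' - ta), of Euclidean length beta, the
   loss is a C^3 function p on [0, 1] with third derivative O(beta^3), because
   the third partial derivatives are bounded near ta.  Up to O(beta^3), both the
   barrier gap and the function maximized on the right-hand side are equal to
   -l(1-l) p''(0)/2, and the maxima of uniformly close functions are close.
   The chain rule for p follows from the continuity of the partial derivatives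
   by applying the mean value theorem to one coordinate at a time. *)

Set Implicit Arguments.
Unset Strict Implicit.
Unset Printing Implicit Defensive.

Import Order.TTheory GRing.Theory Num.Theory.
Import numFieldNormedType.Exports.

Local Open Scope classical_set_scope.
Local Open Scope ring_scope.

(** * Differentiation along lines and coordinatewise increments *)

Section ChainRule.
Context {R : realType}.

(** The two difference quotients are the same function of [h], so existence and value of the
    derivative transfer together. *)
Lemma is_derive_line (V : normedModType R) (f : V -> R) (x v : V) (t df : R) :
  is_derive (x + t *: v) v f df ->
  is_derive t 1 (fun s => f (x + s *: v)) df.
Proof.
have E : (fun h => h^-1 *: (((fun s => f (x + s *: v)) \o shift t) (h *: 1)
             - f (x + t *: v))) =
         (fun h => h^-1 *: ((f \o shift (x + t *: v)) (h *: v)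
             - f (x + t *: v))).
  apply/funext => h; rewrite /= /shift /=; congr (_ *: (f _ - _)).
  by rewrite [h *: 1]mulr1 scalerDl addrCA.
move=> [fv fE]; split; first by rewrite /derivable E.
by rewrite /derive E.
Qed.

Lemma MVT01 (g dg : R -> R) (s : R) : 0 <= s <= 1 ->
  (forall t : R, t \in `[0, 1] -> is_derive t 1 g (dg t)) ->
  exists2 t : R, t \in `[0, 1] & g s - g 0 = dg t * s.
Proof.
move=> /andP[s0 s1] gd.
have sub (t : R) : t \in `[0, s] -> t \in `[0, 1].
  by rewrite !in_itv /= => /andP[-> ts]; rewrite (le_trans ts).
have gc : {within `[0, s], continuous g}.
  by apply: derivable_within_continuous => t /sub/gd[].
have gdo (t : R) : t \in `]0, s[ -> is_derive t 1 g (dg t).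
  by move=> /subset_itv_oo_cc/sub; exact: gd.
have [t ts ->] := MVT_segment s0 gdo gc.
by rewrite subr0; exists t => //; exact: sub.
Qed.

Lemma normr_delta_mx_le1 (n : nat) (i : 'I_n) :
  `|delta_mx i 0 : 'cV[R]_n| <= 1.
Proof.
rewrite [leLHS]/Num.Def.normr /= mx_normrE; apply: bigmax_le => // -[a b] _ /=.
by rewrite mxE; case: (_ && _); rewrite ?normr1 ?normr0.
Qed.

(* The coordinates are moved one at a time, along [s]; the sup-norm ball makes
   all intermediate points stay within [\sum_(i <- s) `|w i|] of [x]. *)
Lemma partial_increment (n : nat) (f : 'cV[R]_n -> R) (c w : 'I_n -> R)
    (e : R) (s : seq 'I_n) (x : 'cV[R]_n) :
  (forall y, `|x - y| <= \sum_(i <- s) `|w i| ->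
     forall i, derivable f y (delta_mx i 0) /\ `|c i - partial i f y| <= e) ->
  `|f (x + \sum_(i <- s) w i *: delta_mx i 0) - f x - \sum_(i <- s) w i * c i|
    <= e * \sum_(i <- s) `|w i|.
Proof.
elim: s x => [|i s IH] x.
  by rewrite !big_nil addr0 !subrr normr0 mulr0.
rewrite !big_cons => H.
have sS : 0 <= \sum_(j <- s) `|w j| by exact: sumr_ge0.
set z := w i *: delta_mx i 0.
have lez : `|z| <= `|w i|.
  by rewrite normrZ -[leRHS]mulr1 ler_wpM2l// normr_delta_mx_le1.
have /IH : forall y, `|x + z - y| <= \sum_(j <- s) `|w j| ->
     forall j, derivable f y (delta_mx j 0) /\ `|c j - partial j f y| <= e.
  move=> y xzy; apply: H.
  have -> : x - y = - z + (x + z - y) by rewrite [x + z]addrC -addrA addKr.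
  by rewrite (le_trans (ler_normD _ _))// normrN lerD.
have inball (t : R) : 0 <= t -> t <= 1 ->
    `|x - (x + t *: z)| <= `|w i| + \sum_(j <- s) `|w j|.
  move=> t0 t1; rewrite opprD addrA subrr sub0r normrN normrZ ger0_norm//.
  rewrite (@le_trans _ _ `|w i|) ?lerDl//.
  by rewrite (le_trans _ lez)// ler_piMl.
have Hd (t : R) : t \in `[0, 1] ->
    is_derive t 1 (fun u => f (x + u *: z)) (w i * partial i f (x + t *: z)).
  rewrite in_itv /= => /andP[t0 t1].
  have /H/(_ i)[/derivableP fi _] :
      `|x - (x + t *: z)| <= `|w i| + \sum_(j <- s) `|w j|.
    exact: inball.
  (* The path [u |-> x + u *: z] runs along the [i]-th axis at speed [w i]; composing with this
     scaling produces the factor [w i]. *)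
  have dw : is_derive t 1 (w i \*: (@id R)) (w i).
    by rewrite -[X in is_derive _ _ _ X]mulr1; exact: is_deriveZ.
  have dl : is_derive (w i * t) 1 (fun u => f (x + u *: delta_mx i 0))
      (partial i f (x + t *: z)).
    by apply: is_derive_line; rewrite mulrC -scalerA.
  rewrite mulrC; have -> : (fun u => f (x + u *: z)) =
      (fun u => f (x + u *: delta_mx i 0)) \o (w i \*: (@id R)).
    by apply/funext => u /=; rewrite [w i *: u]mulrC -scalerA.
  by apply: is_derive1_comp.
have h01 : 0 <= (1 : R) <= 1 by rewrite ler01 lexx.
have [t] := MVT01 h01 Hd.
rewrite in_itv /= => /andP[t0 t1]; rewrite scale1r scale0r addr0 mulr1.
move=> fE IHz.
have /H/(_ i)[_ fc] : `|x - (x + t *: z)| <= `|w i| + \sum_(j <- s) `|w j|.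
  exact: inball.
rewrite mulrDr addrA.
(* The error splits into that of the move along [i], given by the mean value theorem, and that of
   the remaining moves from [x + z], given by induction. *)
have -> : f (x + z + \sum_(j <- s) w j *: delta_mx j 0) - f x
    - (w i * c i + \sum_(j <- s) w j * c j) =
  - (w i * (c i - partial i f (x + t *: z)))
  + (f (x + z + \sum_(j <- s) w j *: delta_mx j 0) - f (x + z)
     - \sum_(j <- s) w j * c j).
  by rewrite mulrBr -fE; ring.
rewrite (le_trans (ler_normD _ _))// lerD//.
by rewrite normrN normrM mulrC ler_wpM2r.
Qed.
End ChainRule.

(** * Directional derivatives from continuous partials; Euclidean norm against sup norm *)

Section Gradient.
Context {R : realType} {n : nat}.
Implicit Types (f : 'cV[R]_n -> R) (U : set 'cV[R]_n) (x v : 'cV[R]_n).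

Lemma col_sum_delta v : v = \sum_i v i 0 *: delta_mx i 0.
Proof.
by rewrite [LHS]matrix_sum_delta; apply: eq_bigr => i _; rewrite big_ord1.
Qed.

(** Near [x] all partial derivatives are within [e'] of their values at [x], so by
    [partial_increment] the linear approximation of [f (x + h *: v)] is off by at most
    [e' * |h| * S]. *)
Lemma is_derive_partials f x v :
  (\forall y \near x, forall i, derivable f y (delta_mx i 0)) ->
  (forall i, {for x, continuous (partial i f)}) ->
  is_derive x v f (\sum_i v i 0 * partial i f x).
Proof.
move=> fd fc; set D := \sum_i _.
suff qD : (fun h => h^-1 *: ((f \o shift x) (h *: v) - f x)) @ 0^' --> D.
  by split; [exact: cvgP qD | exact: cvg_lim qD].
apply/cvgrPdist_le => e e0.
pose S := \sum_i `|v i 0|.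
have S0 : 0 <= S by exact: sumr_ge0.
have S1 : 0 < S + 1 by rewrite ltr_wpDl.
(* The [+ 1] keeps the denominator positive when [v = 0]; only [e' * S <= e] is needed at the
   end. *)
pose e' := e / (S + 1).
have e'0 : 0 < e' by exact: divr_gt0.
pose P i y :=
  derivable f y (delta_mx i 0) /\ `|partial i f x - partial i f y| <= e'.
have near_x : \forall y \near x, forall i, P i y.
  have Pi i : nbhs x (P i).
    have pc : \forall y \near x, `|partial i f x - partial i f y| <= e'.
      by have /cvgrPdist_le := fc i; apply.
    by apply: filterS2 fd pc => y; split.
  exact: (filter_forall (nbhs_filter x) Pi).
move/nbhs_normP : near_x => [r /= r0 xr].
near=> h.
have h0 : h != 0 by near: h; exact: nbhs_dnbhs_neq.
(* For such [h] every intermediate point between [x] and [x + h *: v] stays in the ball of radius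
   [r]. *)
have hS : `|h| * (S + 1) < r.
  rewrite -ltr_pdivlMr//; near: h; apply: dnbhs0_lt; exact: divr_gt0.
have Sh : \sum_i `|h * v i 0| = `|h| * S.
  by rewrite mulr_sumr; apply: eq_bigr => i _; rewrite normrM.
have /partial_increment : forall y, `|x - y| <= \sum_i `|h * v i 0| ->
    forall i, derivable f y (delta_mx i 0) /\
      `|partial i f x - partial i f y| <= e'.
  move=> y xy; apply: xr => /=; apply: le_lt_trans xy _.
  by rewrite Sh (le_lt_trans _ hS)// ler_wpM2l// lerDl.
have -> : \sum_i (h * v i 0) *: delta_mx i 0 = h *: v.
  rewrite [in RHS](col_sum_delta v) scaler_sumr.
  by apply: eq_bigr => i _; rewrite scalerA.
have -> : \sum_i h * v i 0 * partial i f x = h * D.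
  by rewrite mulr_sumr; apply: eq_bigr => i _; rewrite mulrA.
rewrite Sh /= => fh.
have -> : D - h^-1 *: (f (h *: v + x) - f x) =
    - (h^-1 * (f (x + h *: v) - f x - h * D)).
  rewrite [x + _]addrC; set a := f _; set b := f _.
  by rewrite [_ *: _]/(_ * _) mulrBr mulKf// opprB.
rewrite normrN normrM normfV ler_pdivrMl ?normr_gt0//.
rewrite (le_trans fh)// mulrCA ler_wpM2l// /e' mulrAC
  ler_pdivrMr// ler_wpM2l ?lerDl//.
exact: ltW.
Unshelve. all: by end_near. Qed.

Lemma class_C1 k U f : class_C k.+1 U f -> class_C 1 U f.
Proof.
move=> [fc fk]; split => // i; have [fd] := fk i.
by case: k {fk} => [|k] [pc _].
Qed.

Lemma class_C_partial k U f i : class_C k.+1 U f -> class_C k U (partial i f).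
Proof. by move=> [_ fk]; have [] := fk i. Qed.

Lemma is_derive_class_C1 U f x v (t : R) : open U -> class_C 1 U f ->
  U (x + t *: v) ->
  is_derive t 1 (fun s => f (x + s *: v))
    (\sum_i v i 0 * partial i f (x + t *: v)).
Proof.
move=> openU [_ f1] Ut; apply: is_derive_line; apply: is_derive_partials.
  apply: filterS (open_nbhs_nbhs (conj openU Ut)) => y Uy i.
  by have [+ _] := f1 i; apply.
by move=> i; have [_ [+ _]] := f1 i; apply.
Qed.

(** Meant for nested use: each derivative along a line is a sum of partial derivatives weighted by
    the constant coordinates of the direction. *)
Lemma is_derive_lincomb (c : 'I_n -> R) (g : 'I_n -> R -> R) (dg : 'I_n -> R)
    (t : R) :
  (forall i, is_derive t 1 (g i) (dg i)) ->
  is_derive t 1 (fun s => \sum_i c i * g i s) (\sum_i c i * dg i).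
Proof.
move=> gd; have -> : (fun s => \sum_i c i * g i s) = \sum_i (c i \*: g i).
  by apply/funext => s; rewrite fct_sumE.
by apply: is_derive_sum => i; exact: is_deriveZ.
Qed.

Lemma normr_le_enorm x i : `|x i 0| <= enorm x.
Proof.
rewrite -sqrtr_sqr ler_sqrt ?sumr_ge0//.
  rewrite (bigD1 i)//= lerDl sumr_ge0// => j _; exact: sqr_ge0.
by move=> j _; exact: sqr_ge0.
Qed.

(** Neighbourhoods come as sup-norm balls, whereas [beta] is Euclidean; this lets one radius serve
    for both. *)
Lemma mx_norm_le_enorm x : `|x| <= enorm x.
Proof.
rewrite [leLHS]/Num.Def.normr /= mx_normrE; apply: bigmax_le => [|[i j] _ /=].
  exact: sqrtr_ge0.
by rewrite ord1; exact: normr_le_enorm.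
Qed.

Lemma enormN x : enorm (- x) = enorm x.
Proof. by congr Num.sqrt; apply: eq_bigr => i _; rewrite mxE sqrrN. Qed.

End Gradient.

(** * Maxima over [0, 1] and the second order Taylor estimate *)

Section Max01.
Context {R : realType}.
Implicit Types f g : R -> R.

Lemma derivable_attains_max01 f :
  (forall t : R, t \in `[0, 1] -> derivable f t 1) -> attains_max01 f.
Proof.
move=> fd; have fc : {within `[0, 1], continuous f}.
  by apply: derivable_within_continuous => t; exact: fd.
have [l0 l01 fl0] := EVT_max ler01 fc.
by exists l0.
Qed.

Lemma onem_in01 (l : R) : l \in `[0, 1] -> 1 - l \in `[0, 1].
Proof. by rewrite !in_itv /= => /andP[l0 l1]; apply/andP; split; lra. Qed.

Lemma attains_max01_onem f :
  attains_max01 f -> attains_max01 (fun l => f (1 - l)).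
Proof.
move=> [l0 l001 fl0]; exists (1 - l0) => [|l l01]; first exact: onem_in01.
by rewrite subKr; apply: fl0; exact: onem_in01.
Qed.

(** This is [f] minus its chord, read backwards: the barrier puts weight [l] on the starting point,
    which corresponds to time [1 - l]. *)
Lemma attains_max01_chord_gap f :
  (forall t : R, t \in `[0, 1] -> derivable f t 1) ->
  attains_max01 (fun l => f (1 - l) - (l * f 0 + (1 - l) * f 1)).
Proof.
move=> fd.
have -> : (fun l => f (1 - l) - (l * f 0 + (1 - l) * f 1)) =
    (fun l => (f - (cst (f 0) + (f 1 - f 0) \*: (@id R))) (1 - l)).
  apply/funext => l.
  rewrite -[RHS]/(f (1 - l) - (f 0 + (f 1 - f 0) * (1 - l))).
  by ring.
apply: attains_max01_onem; apply: derivable_attains_max01 => t /fd ft.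
by apply: derivableB => //; apply: derivableD => //; exact: derivableZ.
Qed.

Lemma attains_max01_onemM_affine (a b : R) :
  attains_max01 (fun l => l * (1 - l) * (a + b * l)).
Proof.
have -> : (fun l => l * (1 - l) * (a + b * l)) =
    (@id R) * (cst 1 - @id R) * (cst a + b \*: (@id R)) by [].
apply: derivable_attains_max01 => t _.
apply: derivableM; last by apply: derivableD => //; exact: derivableZ.
by apply: derivableM => //; exact: derivableB.
Qed.

(** Attainment makes the supremum of [g] a genuine maximum [g b], so [g b + e] bounds every value of
    [f]. *)
Lemma max01_le f g e : attains_max01 f -> attains_max01 g ->
  (forall l : R, l \in `[0, 1] -> f l <= g l + e) -> max01 f <= max01 g + e.
Proof.
move=> [a a01 fa] [b b01 gb] fg.
have -> : max01 g = g b.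
  apply/eqP; rewrite eq_le; apply/andP; split.
    by apply: ge_sup => [|_ [l l01 <-]]; [exists (g b), b | exact: gb].
  apply: ub_le_sup; last by exists b.
  by exists (g b) => _ [l l01 <-]; exact: gb.
apply: ge_sup => [|_ [l l01 <-]]; first by exists (f a), a.
by rewrite (le_trans (fg _ l01))// lerD2r; exact: gb.
Qed.

Lemma max01_dist f g e : attains_max01 f -> attains_max01 g ->
  (forall l : R, l \in `[0, 1] -> `|f l - g l| <= e) ->
  `|max01 f - max01 g| <= e.
Proof.
move=> fm gm fg.
have ? : max01 f <= max01 g + e.
  by apply: max01_le => // l /fg; rewrite ler_norml => /andP[]; lra.
have ? : max01 g <= max01 f + e.
  by apply: max01_le => // l /fg; rewrite ler_norml => /andP[]; lra.
by rewrite ler_norml; apply/andP; split; lra.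
Qed.

(* Subtracting from [p] its second order Taylor polynomial at [0] leaves a
   function all of whose derivatives up to order 2 are bounded by [C] on
   [0, 1]; the left-hand side vanishes on polynomials of degree at most 2. *)
Lemma taylor_gap (p p1 p2 p3 : R -> R) (C l : R) :
  (forall t : R, t \in `[0, 1] -> is_derive t 1 p (p1 t)) ->
  (forall t : R, t \in `[0, 1] -> is_derive t 1 p1 (p2 t)) ->
  (forall t : R, t \in `[0, 1] -> is_derive t 1 p2 (p3 t)) ->
  (forall t : R, t \in `[0, 1] -> `|p3 t| <= C) ->
  l \in `[0, 1] ->
  `|p (1 - l) - (l * p 0 + (1 - l) * p 1) -
    l * (1 - l) * (p1 0 - p1 1 + 2^-1 * ((1 - l) * p2 0 + l * p2 1))| <= 4 * C.
Proof.
move=> pd p1d p2d p3C l01.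
have zero_in01 : (0 : R) \in `[0, 1] by rewrite in_itv /= lexx ler01.
have one_in01 : (1 : R) \in `[0, 1] by rewrite in_itv /= lexx ler01.
(* A function vanishing at 0 inherits on [0, 1] the bound of its derivative, by the mean value
   theorem; this carries [C] from [p3] to [q2], [q1] and [q] in turn. *)
have bnd (g dg : R -> R) (t : R) :
    (forall t : R, t \in `[0, 1] -> is_derive t 1 g (dg t)) ->
    (forall t : R, t \in `[0, 1] -> `|dg t| <= C) -> g 0 = 0 ->
    t \in `[0, 1] -> `|g t| <= C.
  move=> gd gC g0; rewrite in_itv /= => t01.
  have [u u01] := MVT01 t01 gd; rewrite g0 subr0 => ->.
  move/andP : t01 => [t0 t1]; rewrite normrM (ger0_norm t0).
  by rewrite (le_trans (ler_piMr _ t1))// gC.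
pose q2 (t : R) := p2 t - p2 0.
pose q1 (t : R) := p1 t - (p1 0 + t * p2 0).
pose q (t : R) := p t - (p 0 + t * p1 0 + t ^+ 2 * (p2 0 / 2)).
have q2d (t : R) : t \in `[0, 1] -> is_derive t 1 q2 (p3 t).
  move=> /p2d ?; have -> : q2 = p2 - cst (p2 0) by [].
  by apply: is_derive_eq; rewrite subr0.
have q1d (t : R) : t \in `[0, 1] -> is_derive t 1 q1 (q2 t).
  move=> /p1d ?.
  have -> : q1 = p1 - (cst (p1 0) + p2 0 \*: (@id R)).
    by apply/funext => u; rewrite /q1 [u * _]mulrC.
  by apply: is_derive_eq; rewrite add0r [_ *: _]mulr1.
have qd (t : R) : t \in `[0, 1] -> is_derive t 1 q (q1 t).
  move=> /pd ?.
  have -> : q = p - (cst (p 0) + p1 0 \*: (@id R) +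
                     (p2 0 / 2) \*: ((@id R) * (@id R))).
    by apply/funext => u; rewrite /q [u * _]mulrC [u ^+ 2 * _]mulrC.
  apply: is_derive_eq; rewrite add0r [_ *: _]mulr1 /q1 /GRing.scale /=.
  by congr (_ - (_ + _)); field.
have q2C t : t \in `[0, 1] -> `|q2 t| <= C.
  by apply: bnd q2d p3C _; rewrite /q2 subrr.
have q1C t : t \in `[0, 1] -> `|q1 t| <= C.
  by apply: bnd q1d q2C _; rewrite /q1 mul0r addr0 subrr.
have qC t : t \in `[0, 1] -> `|q t| <= C.
  by apply: bnd qd q1C _; rewrite /q expr0n !mul0r !addr0 subrr.
have C0 : 0 <= C by exact: le_trans (q2C _ zero_in01).
(* The quadratic Taylor part cancels. Four terms remain, each a value bounded by [C] times a
   coefficient in [0, 1], whence [4 * C]. *)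
have -> : p (1 - l) - (l * p 0 + (1 - l) * p 1) -
    l * (1 - l) * (p1 0 - p1 1 + 2^-1 * ((1 - l) * p2 0 + l * p2 1)) =
    q (1 - l) - (1 - l) * q 1 + l * (1 - l) * (q1 1 - 2^-1 * l * q2 1).
  by rewrite /q /q1 /q2; field.
have := qC _ (onem_in01 l01); have := qC _ one_in01.
have := q1C _ one_in01; have := q2C _ one_in01.
move: l01; rewrite in_itv /= => /andP[l0 l1].
rewrite !ler_norml => /andP[? ?] /andP[? ?] /andP[? ?] /andP[? ?].
have l1' : 0 <= 1 - l by rewrite subr_ge0.
have mulC (c z : R) :
    0 <= c -> c <= 1 -> - C <= z -> z <= C -> - C <= c * z <= C.
  by move=> *; apply/andP; split; nra.
have /andP[? ?] : - C <= (1 - l) * q 1 <= C by apply: mulC => //; lra.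
have ll0 : 0 <= l * (1 - l) by exact: mulr_ge0.
have ll1 : l * (1 - l) <= 1 by nra.
have /andP[? ?] : - C <= (l * (1 - l)) * q1 1 <= C by exact: mulC.
have lll0 : 0 <= l * (1 - l) * (2^-1 * l) by apply: mulr_ge0 => //; lra.
have lll1 : l * (1 - l) * (2^-1 * l) <= 1 by apply: mulr_ile1 => //; lra.
have /andP[? ?] : - C <= (l * (1 - l) * (2^-1 * l)) * q2 1 <= C by exact: mulC.
by apply/andP; split; lra.
Qed.

End Max01.

(** * Gradient and Hessian forms as sums, and local bounds *)

Section SecondOrder.
Context {R : realType} {n : nat}.
Implicit Types (f : 'cV[R]_n -> R) (x v : 'cV[R]_n).

Lemma gradient_formE f x v :
  (v^T *m gradient f x) 0 0 = \sum_i v i 0 * partial i f x.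
Proof. by rewrite mxE; apply: eq_bigr => i _; rewrite !mxE. Qed.

(** The column index of [hessian] is the inner derivative, so summing over columns outermost gives
    the order in which differentiating twice along a line produces the terms. *)
Lemma hessian_formE f x v : (v^T *m hessian f x *m v) 0 0 =
  \sum_i v i 0 * \sum_j v j 0 * partial j (partial i f) x.
Proof.
rewrite mxE; apply: eq_bigr => i _; rewrite mulrC mxE; congr (_ * _).
by apply: eq_bigr => j _; rewrite !mxE.
Qed.

(** By homogeneity of degrees 1 and 2 the powers of [b] are absorbed into the vector; with
    [b = beta] and [u = mu] this vector is [tb' - ta]. *)
Lemma scaled_forms (b c1 c2 : R) (u g1 g2 : 'cV[R]_n) (H1 H2 : 'M[R]_n) :
  b * (u^T *m (g1 - g2)) 0 0
    + 2^-1 * b ^+ 2 * (u^T *m (c1 *: H1 + c2 *: H2) *m u) 0 0 =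
  ((b *: u)^T *m g1) 0 0 - ((b *: u)^T *m g2) 0 0
    + 2^-1 * (c1 * ((b *: u)^T *m H1 *m (b *: u)) 0 0
              + c2 * ((b *: u)^T *m H2 *m (b *: u)) 0 0).
Proof.
have -> : (b *: u)^T = b *: u^T by apply/matrixP => i j; rewrite !mxE.
rewrite mulmxBr mulmxDr mulmxDl -!scalemxAr -!scalemxAl.
move: (u^T *m g1) (u^T *m g2) (u^T *m H1 *m u) (u^T *m H2 *m u).
by move=> A1 A2 B1 B2; rewrite !mxE; ring.
Qed.

(** With [c] the coordinates of the direction, each contraction costs a factor [n%:R * beta]. *)
Lemma normr_lincomb_le (c a : 'I_n -> R) (b A : R) :
  (forall i, `|c i| <= b) -> (forall i, `|a i| <= A) ->
  `|\sum_i c i * a i| <= n%:R * (b * A).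
Proof.
move=> cb aA; rewrite (le_trans (ler_norm_sum _ _ _))//.
rewrite -[n in n%:R]card_ord mulr_natl -sumr_const; apply: ler_sum => i _.
by rewrite normrM ler_pM.
Qed.

Lemma near_family_bounded (I : finType) (V : normedModType R)
    (g : I -> V -> R) (x : V) :
  (forall i, {for x, continuous (g i)}) ->
  exists2 M, 0 < M & \forall y \near x, forall i, `|g i y| <= M.
Proof.
move=> gc; exists (1 + \sum_i `|g i x|).
  by rewrite ltr_wpDr// sumr_ge0.
have gi i : nbhs x [set y | `|g i y| <= 1 + \sum_i `|g i x|].
  have /cvgrPdist_le/(_ 1 ltr01) := gc i; apply: filterS => y /= gxy.
  have -> : g i y = - (g i x - g i y) + g i x by rewrite opprB subrK.
  rewrite (le_trans (ler_normD _ _))// normrN lerD//.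
  by rewrite (bigD1 i)//= lerDl sumr_ge0.
exact: (filter_forall (nbhs_filter x) gi).
Qed.

End SecondOrder.

(** * Uniform constants near [ta] and comparison of the two maxima *)

Theorem theorem3p1 (R : realType) (L : nat) (d : 'I_L.+1 -> nat)
    (U : set 'cV[R]_(param_dim d)) (loss : 'cV[R]_(param_dim d) -> R)
    (ta : 'cV[R]_(param_dim d))
    (openU : open U) (lossC3 : class_C 3 U loss) (Uta : U ta) :
  exists K delta : R, [/\ 0 < K, 0 < delta &
    forall (tb : 'cV[R]_(param_dim d)) (P : forall i : 'I_L.+1, 'M[R]_(d i)),
    is_layer_perm P ->
    let tb' := perm_act P tb in
    let beta := enorm (ta - tb') in
    let mu := beta^-1 *: (tb' - ta) in
    let Ha := hessian loss ta in
    let Hb := hessian loss tb' in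
    let rhs (l : R) :=
      l * (1 - l) *
      (beta * (mu^T *m (gradient loss ta - gradient loss tb')) 0 0
       + 2^-1 * beta ^+ 2 * (mu^T *m ((1 - l) *: Ha + l *: Hb) *m mu) 0 0) in
    U tb' ->
    (forall l : R, l \in `]0, 1[ -> U (l *: ta + (1 - l) *: tb')) ->
    0 < beta -> beta < delta ->
    [/\ attains_max01 (barrier_gap loss ta tb'),
        attains_max01 rhs &
        `|loss_barrier loss ta tb' - max01 rhs| <= K * beta ^+ 3]].
Proof.
(* Indexing by triples makes the third partial derivatives one finite family, with a common bound
   [M] and radius [delta] that depend only on [loss] and [ta]. *)
pose D3 (p : 'I_(param_dim d) * 'I_(param_dim d) * 'I_(param_dim d)) :=
  partial p.2 (partial p.1.2 (partial p.1.1 loss)).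
have D3c p : {for ta, continuous (D3 p)}.
  have [+ _] := class_C_partial p.2
    (class_C_partial p.1.2 (class_C_partial p.1.1 lossC3)).
  exact.
have [M M0 /nbhs_normP[delta /= delta0 D3M]] := near_family_bounded D3c.
pose N : R := (param_dim d)%:R.
have N0 : 0 <= N by exact: ler0n.
have K0 : 0 < 4 * (N * (N * (N * M))) + 1 by rewrite ltr_wpDl// !mulr_ge0// ltW.
(* The 4 is that of [taylor_gap], and each [N] comes from one of the three contractions in [p3];
   adding 1 keeps the constant positive when [N = 0]. *)
exists (4 * (N * (N * (N * M))) + 1), delta; split=> //.
move=> tb P _; set tb' := perm_act P tb; set beta := enorm (ta - tb').
set mu := beta^-1 *: _; set Ha := hessian loss ta; set Hb := hessian loss tb'.
set rhs := (X in max01 X).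
move=> Utb segU beta0 beta_delta.
have [v vE] : exists v, v = tb' - ta by exists (tb' - ta).
have enorm_v : enorm v = beta by rewrite vE -enormN opprB.
have vbeta i : `|v i 0| <= beta by rewrite -enorm_v; exact: normr_le_enorm.
have muv : beta *: mu = v by rewrite vE scalerA divff ?scale1r ?gt_eqF.
have lineE l : l *: ta + (1 - l) *: tb' = ta + (1 - l) *: v.
  by rewrite vE; apply/matrixP => a b; rewrite !mxE; ring.
have line0 : ta + 0 *: v = ta by rewrite scale0r addr0.
have line1 : ta + 1 *: v = tb' by rewrite vE scale1r addrC subrK.
(* The segment hypothesis covers only the open interval; the endpoints are [ta] and [tb']. *)
have Ut (t : R) : t \in `[0, 1] -> U (ta + t *: v).
  rewrite in_itv /= !le_eqVlt => /andP[/predU1P[<-|t0] /predU1P[t1|t1]].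
  - by rewrite line0.
  - by rewrite line0.
  - by rewrite t1 line1.
  - rewrite -(subKr 1 t) -lineE; apply: segU; rewrite in_itv /=.
    by rewrite subr_gt0 t1 ltrBlDr ltrDl.
pose p (t : R) := loss (ta + t *: v).
pose p1 (t : R) := \sum_i v i 0 * partial i loss (ta + t *: v).
pose p2 (t : R) :=
  \sum_i v i 0 * \sum_j v j 0 * partial j (partial i loss) (ta + t *: v).
pose p3 (t : R) := \sum_i v i 0 * \sum_j v j 0 *
  \sum_k v k 0 * partial k (partial j (partial i loss)) (ta + t *: v).
have pd (t : R) : t \in `[0, 1] -> is_derive t 1 p (p1 t).
  by move=> /Ut; apply: is_derive_class_C1 => //; exact: class_C1 lossC3.
have p1d (t : R) : t \in `[0, 1] -> is_derive t 1 p1 (p2 t).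
  move=> /Ut Utv; apply: is_derive_lincomb => i.
  apply: is_derive_class_C1 openU _ Utv.
  exact: class_C1 (class_C_partial i lossC3).
have p2d (t : R) : t \in `[0, 1] -> is_derive t 1 p2 (p3 t).
  move=> /Ut Utv; apply: is_derive_lincomb => i; apply: is_derive_lincomb => j.
  apply: is_derive_class_C1 openU _ Utv.
  exact: class_C_partial (class_C_partial i lossC3).
have p3M (t : R) : t \in `[0, 1] ->
    `|p3 t| <= N * (beta * (N * (beta * (N * (beta * M))))).
  rewrite in_itv /= => /andP[t0 t1].
  (* Three contractions with [v] give [beta ^+ 3]; what is left is a third partial derivative at a
     point of the [delta]-ball around [ta]. *)
  do 3![apply: normr_lincomb_le => // ?].
  apply: (D3M _ _ (_, _, _)) => /=.
  rewrite opprD addrA subrr sub0r normrN normrZ (ger0_norm t0).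
  rewrite (le_lt_trans _ beta_delta)// -enorm_v.
  by rewrite (le_trans _ (mx_norm_le_enorm v))// ler_piMl.
have gapE : barrier_gap loss ta tb' =
    fun l => p (1 - l) - (l * p 0 + (1 - l) * p 1).
  by apply/funext => l; rewrite /barrier_gap lineE /p line0 line1.
have rhsE l : rhs l =
    l * (1 - l) * (p1 0 - p1 1 + 2^-1 * ((1 - l) * p2 0 + l * p2 1)).
  have p1E (t : R) : p1 t = (v^T *m gradient loss (ta + t *: v)) 0 0.
    by rewrite gradient_formE.
  have p2E (t : R) : p2 t = (v^T *m hessian loss (ta + t *: v) *m v) 0 0.
    by rewrite hessian_formE.
  by rewrite !p1E !p2E line0 line1 -muv -scaled_forms.
have gap_max : attains_max01 (barrier_gap loss ta tb').
  by rewrite gapE; apply: attains_max01_chord_gap => t /pd[].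
have rhs_max : attains_max01 rhs.
  (* Collecting powers of [l] makes the bracket affine. *)
  have -> : rhs = fun l => l * (1 - l) *
      (p1 0 - p1 1 + 2^-1 * p2 0 + 2^-1 * (p2 1 - p2 0) * l).
    by apply/funext => l; rewrite rhsE; move: (p1) (p2) => a b; ring.
  exact: attains_max01_onemM_affine.
split => //; apply: max01_dist => // l l01.
rewrite rhsE gapE (le_trans (taylor_gap pd p1d p2d p3M l01))//.
have -> : 4 * (N * (beta * (N * (beta * (N * (beta * M)))))) =
  4 * (N * (N * (N * M))) * beta ^+ 3 by ring.
by apply: ler_wpM2r; [apply: exprn_ge0; exact: ltW | rewrite lerDl].
Qed.
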